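(* Let $t\ge 2$ and $v\ge t+1$, and let $(V,\mathcal{B})$ be a Steiner $t$-design $S(t,t+1,v)$. Let $M_{t-1}$ be the binary matrix whose columns correspond to all the blocks of $\mathcal{B}$, whose rows correspond to all $(t-1)$-subsets of $V$, and whose $(i,j)$ entry is $1$ if and only if the $(t-1)$-subset of row $i$ is contained in the block of column $j$ (and is $0$ otherwise). Then: (1) $M_{t-1}$ is a $\binom{v}{t-1}\times \left(\binom{v}{t}/(t+1)\right)$ matrix; (2) $M_{t-1}$ has row weight $\frac{v-t+1}{2}$ (every row has exactly this many ones); (3) $M_{t-1}$ has column weight $\binom{t+1}{t-1}$ (every column has exactly this many ones).
   Context: A Steiner $t$-design $S(t,k,v)$ is an ordered pair $(V,\mathcal{B})$ where $|V|=v$ and $\mathcal{B}$ is a collection of $k$-subsets (blocks) of $V$ such that every $t$-subset of $V$ occurs in exactly one block of $\mathcal{B}$. *)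

(* Defs.v *)
From mathcomp Require Import all_boot all_order all_algebra.

Set Implicit Arguments.
Unset Strict Implicit.
Unset Printing Implicit Defensive.

Import GRing.Theory.
Local Open Scope ring_scope.

(* A set of blocks suffices: for t <= k, the uniqueness condition already
   forbids repeated blocks. *)
Definition steiner_design (t k v : nat) (V : finType) (B : {set {set V}}) :=
  [/\ #|V| = v,
      forall b : {set V}, b \in B -> #|b| = k
    & forall T : {set V}, #|T| = t -> #|[set b in B | T \subset b]| = 1%N].

Definition subsets_of_size (s : nat) (V : finType) : {set {set V}} :=
  [set A : {set V} | #|A| == s].

Definition enumerates (T : finType) (m : nat) (f : 'I_m -> T) (A : {set T}) :=
  injective f /\ [set f i | i : 'I_m] = A.

(* The ordering of rows and columns is left arbitrary. The dimensions m and n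
   are not built in: they are determined by the two enumerations. *)
Definition is_inclusion_matrix (s : nat) (V : finType) (B : {set {set V}})
    (m n : nat) (M : 'M['F_2]_(m, n)) :=
  exists (r : 'I_m -> {set V}) (c : 'I_n -> {set V}),
    [/\ enumerates r (subsets_of_size s V),
        enumerates c B
      & forall i j, M i j = (r i \subset c j)%:R].

Definition row_weight (m n : nat) (M : 'M['F_2]_(m, n)) (i : 'I_m) : nat :=
  #|[set j | M i j == 1]|.

Definition col_weight (m n : nat) (M : 'M['F_2]_(m, n)) (j : 'I_n) : nat :=
  #|[set i | M i j == 1]|.

Lemma inclusion_matrix_exists (s : nat) (V : finType) (B : {set {set V}}) :
  exists m n (M : 'M['F_2]_(m, n)), is_inclusion_matrix s B M.
Proof.
have enumP (A : {set {set V}}) : enumerates (@enum_val _ (mem A)) A.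
  split; first exact: enum_val_inj.
  apply/setP => x; apply/imsetP/idP => [[i _ ->]|xA]; first exact: enum_valP.
  by exists (enum_rank_in xA x); rewrite ?enum_rankK_in.
pose r := @enum_val _ (mem (subsets_of_size s V)).
pose c := @enum_val _ (mem B).
exists #|subsets_of_size s V|, #|B|, (\matrix_(i, j) (r i \subset c j)%:R).
by exists r, c; split=> [||i j]; rewrite ?mxE //; apply: enumP.
Qed.

(* Main.v *)
(* Fix an s-subset S with s <= t and count the pairs (T, b) where S is contained
   in T, T in the block b, and T has t elements: every T lies in one block, so
   the number of blocks through S times C(k - s, t - s) is C(v - s, t - s).
   Taking s = 0 and s = t - 1 with k = t + 1 gives the number of columns and the
   row weight. *)
Require Import Defs.
From mathcomp Require Import all_boot all_order all_algebra.

Set Implicit Arguments.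
Unset Strict Implicit.
Unset Printing Implicit Defensive.

Import GRing.Theory.
Local Open Scope ring_scope.

(** The maps [U :|: S] and [T :\: S] are mutually inverse bijections between the subsets of
    [A :\: S] of size [t - #|S|] and the sets counted here. *)
Lemma card_sets_between (V : finType) (S A : {set V}) (t : nat) :
  S \subset A -> (#|S| <= t)%N ->
  #|[set T : {set V} | [&& S \subset T, T \subset A & #|T| == t]]|
    = 'C(#|A| - #|S|, t - #|S|).
Proof.
move=> sSA leSt.
have <- : #|A :\: S| = (#|A| - #|S|)%N by rewrite cardsD (setIidPr sSA).
rewrite -cards_draws -[RHS](card_in_imset (f := fun U => S :|: U)); last first.
  apply: (can_in_inj (g := fun T => T :\: S)) => U; rewrite inE subsetD.
  by case/andP=> /andP[_ /setDidPl dUS] _; rewrite setDUl setDv set0U.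
congr #|pred_of_set _|; apply/setP=> T; rewrite inE.
apply/and3P/imsetP => [[sST sTA /eqP cT]|[U]].
  exists (T :\: S); last by rewrite -{1}(setIidPr sST) setID.
  by rewrite inE setSD //= cardsD (setIidPr sST) cT.
rewrite inE subsetD => /andP[/andP[sUA dUS] /eqP cU] ->.
rewrite subsetUl subUset sSA sUA cardsU setIC (disjoint_setI0 dUS) cards0 cU.
by rewrite subn0 subnKC.
Qed.

Lemma steiner_replication (t k v : nat) (V : finType) (B : {set {set V}})
    (S : {set V}) :
  steiner_design t k v B -> (#|S| <= t)%N ->
  (#|[set b in B | S \subset b]| * 'C(k - #|S|, t - #|S|)
     = 'C(v - #|S|, t - #|S|))%N.
Proof.
case=> cV cB oneB leSt.
pose P (T : {set V}) := (S \subset T) && (#|T| == t).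
rewrite -{1}cV -cardsT -card_sets_between ?subsetT //.
(* Every inner sum is 1 by the Steiner condition, so the double sum counts the [T]; exchanging the
   sums then counts the same pairs block by block. *)
transitivity (\sum_(T | P T) \sum_(b in B | T \subset b) 1)%N; last first.
  rewrite -sum1_card; apply: eq_big => [T|T /andP[_ /eqP cT]].
    by rewrite inE subsetT.
  by rewrite -[RHS](oneB T cT) -sum1_card; apply: eq_bigl => b; rewrite inE.
rewrite (exchange_big_dep (mem B)) /= => [|T b _ /andP[] //].
rewrite -sum_nat_const big_mkcond [RHS]big_mkcond /=; apply: eq_bigr => b _.
rewrite inE; case: ifP => [/andP[bB sSb]|]; rewrite ?bB.
  rewrite -(cB b bB) -card_sets_between // -sum1_card; apply: eq_bigl => T.
  by rewrite inE /P andbAC andbA.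
(* A block that does not contain [S] contains no superset of [S], so it contributes 0. *)
case: (b \in B) => //= nSb; rewrite big_pred0 // => T; apply/negP.
by case/andP=> /andP[sST _] /(subset_trans sST); rewrite nSb.
Qed.

(** Turns a count of row or column indices into a count of subsets of [V], so the weights do not
    depend on the chosen ordering. *)
Lemma card_enumerates (T : finType) (m : nat) (f : 'I_m -> T) (A : {set T})
    (P : pred T) :
  enumerates f A -> #|[set i | P (f i)]| = #|[set x in A | P x]|.
Proof.
case=> injf <-; rewrite -(card_imset _ injf); congr #|pred_of_set _|.
apply/setP=> x; rewrite inE; apply/imsetP/andP => [[i]|[/imsetP[i _ ->] Pi]].
  by rewrite inE => Pi ->; rewrite imset_f.
by exists i; rewrite ?inE.
Qed.

Lemma enumerates_mem (T : finType) (m : nat) (f : 'I_m -> T) (A : {set T}) i :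
  enumerates f A -> f i \in A.
Proof. by case=> _ <-; apply: imset_f. Qed.

Lemma enumerates_size (T : finType) (m : nat) (f : 'I_m -> T) (A : {set T}) :
  enumerates f A -> m = #|A|.
Proof. by case=> injf <-; rewrite card_imset // card_ord. Qed.

Lemma natr_bool_eq1 (R : nzRingType) (b : bool) : (b%:R == 1 :> R) = b.
Proof. by case: b; rewrite ?eqxx // eq_sym oner_eq0. Qed.

Theorem proposition3p14 (t v : nat) (V : finType) (B : {set {set V}})
    (m n : nat) (M : 'M['F_2]_(m, n)) :
  (2 <= t)%N -> (t.+1 <= v)%N ->
  steiner_design t t.+1 v B ->
  is_inclusion_matrix t.-1 B M ->
  [/\ m = 'C(v, t.-1) /\ n%:R = 'C(v, t)%:R / t.+1%:R :> rat,
      forall i : 'I_m, (row_weight M i)%:R = (v%:R - t%:R + 1) / 2 :> rat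
    & forall j : 'I_n, col_weight M j = 'C(t.+1, t.-1)].
Proof.
move=> t2 tv desB [r [c [enr enc ME]]]; have [cV cB _] := desB.
split=> [|i|j].
- split; first by rewrite (enumerates_size enr) card_draws cV.
  (* Every block contains the empty set, and ['C(t.+1, t)] is [t.+1]. *)
  have := steiner_replication (S := set0) desB; rewrite cards0 !subn0 => /(_ isT).
  rewrite (_ : [set b in B | _] = B); last first.
    by apply/setP=> b; rewrite inE sub0set andbT.
  rewrite binSn -(enumerates_size enc) => <-.
  by rewrite natrM mulfK // Num.Theory.pnatr_eq0.
- have /eqP cr : #|r i| == t.-1 by have := enumerates_mem i enr; rewrite inE.
  have -> : row_weight M i = #|[set b in B | r i \subset b]|.
    rewrite -(card_enumerates _ enc); congr #|pred_of_set _|.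
    by apply/setP=> j; rewrite !inE ME natr_bool_eq1.
  have := steiner_replication (S := r i) desB; rewrite cr leq_pred => /(_ isT).
  (* From here [t] stands for the former [t.-1]; the binomials become ['C(2, 1)] and ['C(v - t, 1)],
     so twice the row weight is [v - t]. *)
  case: t t2 tv {desB cB ME enr cr M} => // t _ tv /=.
  rewrite -addn2 addKn subSnn !bin1 => eqv.
  have -> : v%:R - t.+1%:R + 1 = (v - t)%:R :> rat.
    by rewrite natrB ?(ltnW (ltnW tv)) // -natr1 opprD addrA subrK.
  by rewrite -eqv natrM mulfK.
(* All subsets of size [t.-1] of the block [c j] occur among the rows. *)
- rewrite -(cB _ (enumerates_mem j enc)) -cards_draws.
  transitivity #|[set A in subsets_of_size t.-1 V | A \subset c j]|.
    rewrite -(card_enumerates _ enr); congr #|pred_of_set _|.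
    by apply/setP=> i; rewrite !inE ME natr_bool_eq1.
  by congr #|pred_of_set _|; apply/setP=> A; rewrite !inE andbC.
Qed.
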